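(* Let $G$ be a finitely generated group hyperbolic relative to a collection of subgroups $\{H_1,\ldots,H_m\}$. Let $P$ and $R$ be two strongly relatively quasi-convex subgroups of $G$. Then $P\cap R$ is strongly relatively quasi-convex.
   Context: Relative hyperbolicity. Let $X$ be a finite set generating $G$ relative to $\{H_1,\dots,H_m\}$, i.e. $G$ is generated by $X\cup H_1\cup\dots\cup H_m$. Put $F=\widetilde H_1\ast\dots\ast\widetilde H_m\ast F(X)$, where $\widetilde H_i$ is an isomorphic copy of $H_i$ and $F(X)$ is free with basis $X$, and $\mathcal H=\bigsqcup_i(\widetilde H_i\setminus\{1\})$. $G$ has a finite relative presentation $\langle X,H_1,\dots,H_m\mid R=1,R\in\mathcal R\rangle$ if $\mathcal R$ is a finite set of words over $X^{\pm1}\cup\mathcal H$ (closed under cyclic shifts and inverses) whose normal closure in $F$ is the kernel of the canonical epimorphism $F\to G$. Its relative Dehn function is the smallest function $f$ such that every word $W$ over $X^{\pm1}\cup\mathcal H$ of length at most $n$ representing $1$ in $G$ equals in $F$ a product $\prod_{i=1}^kf_i^{-1}R_if_i$ with $R_i\in\mathcal R$, $f_i\in F$, $k\le f(n)$. $G$ is hyperbolic relative to $\{H_1,\dots,H_m\}$ if it has a finite relative presentation whose relative Dehn function is bounded from above by $Ln$ for some constant $L$. Quasi-convexity. Let $X$ be a finite generating set of $G$ in the ordinary sense, $dist_X$ the word metric on $G$ with respect to $X$, and $\Gamma(G,X\cup\mathcal H)$ the Cayley graph of $G$ with respect to the generating set $X\cup H_1\cup\dots\cup H_m$, with edges of length $1$.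 A subgroup $R\le G$ is relatively quasi-convex with respect to $\{H_1,\dots,H_m\}$ if there is a constant $\sigma>0$ such that for any $f,g\in R$, any geodesic path $p$ from $f$ to $g$ in $\Gamma(G,X\cup\mathcal H)$, and any vertex $v\in p$ there is $w\in R$ with $dist_X(v,w)\le\sigma$ (for relatively hyperbolic $G$ this does not depend on the choice of $X$). It is strongly relatively quasi-convex if, in addition, $R\cap H_i^g$ is finite for all $i=1,\dots,m$ and $g\in G$, where $H_i^g=g^{-1}H_ig$. *)

(* Defs.v *)
From HB Require Import structures.
From mathcomp Require Import all_boot finmap.
From mathcomp Require Import boolp classical_sets functions cardinality.

Set Implicit Arguments.
Unset Strict Implicit.
Unset Printing Implicit Defensive.

Local Open Scope group_scope.

(* Groups are abstract, possibly infinite [groupType]s, and subgroups are the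
   [groupClosed] predicates on them.  Excluded middle holds throughout, so
   boolean predicates are arbitrary subsets. *)

Section Intersection.
Variables (G : groupType) (P R : groupClosed G).

Definition subgroupI : {pred G} := [pred x | (x \in P) && (x \in R)].

Fact subgroupI_closed : group_closed subgroupI.
Proof.
split=> [|x y]; rewrite !inE ?gpred1//.
by case/andP=> xP xR /andP[yP yR]; rewrite !gpredM ?gpredV.
Qed.

HB.instance Definition _ :=
  isMulClosed.Build G subgroupI (group_closedM subgroupI_closed).
HB.instance Definition _ :=
  isMul1Closed.Build G subgroupI (proj1 subgroupI_closed).
HB.instance Definition _ :=
  isInvClosed.Build G subgroupI (group_closedV subgroupI_closed).

End Intersection.

Section WordMetric.
Variables (G : groupType) (X : {fset G}).

(* [(x, true)] stands for x and [(x, false)] for its formal inverse. *)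
Definition gen_val (s : X * bool) : G := if s.2 then val s.1 else (val s.1)^-1.

Definition generates : Prop :=
  forall g : G, exists w : seq (X * bool), g = \prod_(s <- w) gen_val s.

Definition has_length (g : G) (n : nat) : Prop :=
  exists2 w : seq (X * bool), size w = n & g = \prod_(s <- w) gen_val s.

(* The junk value 0 is never used when X generates G. *)
Definition word_length (g : G) : nat :=
  if pselect (exists n, `[< has_length g n >]) is left ex then ex_minn ex
  else 0.

Definition dist (u v : G) : nat := word_length (u^-1 * v).

End WordMetric.

Section RelativeWords.
Variables (G : groupType) (X : {fset G}) (m : nat) (H : 'I_m -> groupClosed G).

Definition nontrivial (i : 'I_m) := {h : G | (h \in H i) && (h != 1)}.

(* The [Per i] are disjoint copies of the sets H_i \ {1}: an element lying in
   several of the H_i, or in X, gives several distinct letters. *)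
Inductive letter : Type :=
| Gen of X * bool
| Per (i : 'I_m) of nontrivial i.

Definition word := seq letter.

Definition letter_val (l : letter) : G :=
  match l with Gen s => gen_val s | Per _ h => val h end.

Definition word_val (w : word) : G := \prod_(l <- w) letter_val l.

Fact nontrivialV (i : 'I_m) (h : nontrivial i) :
  ((val h)^-1 \in H i) && ((val h)^-1 != 1).
Proof. by case: h => h /= /andP[hH h1]; rewrite gpredV hH invg_eq1. Qed.

Definition letter_inv (l : letter) : letter :=
  match l with
  | Gen s => Gen (s.1, ~~ s.2)
  | Per i h => Per (Sub (val h)^-1 (nontrivialV h) : nontrivial i)
  end.

Definition word_inv (w : word) : word := rev (map letter_inv w).

Definition generates_relatively : Prop := forall g : G, exists w, g = word_val w.

(* Equality in the free product F of F(X) and copies of the H_i.  F is the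
   quotient of the monoid of words by this congruence; products and inverses
   in F are represented by [++] and [word_inv]. *)
Inductive eqF : word -> word -> Prop :=
| eqF_refl w : eqF w w
| eqF_sym w1 w2 : eqF w1 w2 -> eqF w2 w1
| eqF_trans w2 w1 w3 : eqF w1 w2 -> eqF w2 w3 -> eqF w1 w3
| eqF_cancel u v l : eqF (u ++ [:: l; letter_inv l] ++ v) (u ++ v)
| eqF_mul u v i (h k hk : nontrivial i) : val h * val k = val hk ->
    eqF (u ++ [:: Per h; Per k] ++ v) (u ++ [:: Per hk] ++ v).

(* A subset of F is given by the set of all words representing its elements. *)
Definition normal_subgroupF (N : set word) : Prop :=
  [/\ forall w1 w2, eqF w1 w2 -> N w1 -> N w2,
      N [::],
      forall w1 w2, N w1 -> N w2 -> N (w1 ++ w2),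
      forall w, N w -> N (word_inv w)
    & forall f w, N w -> N (word_inv f ++ w ++ f)].

Definition normal_closure (Rs : set word) : set word :=
  [set w | forall N, normal_subgroupF N -> (Rs `<=` N)%classic -> N w]%classic.

Definition finite_relative_presentation (Rs : set word) : Prop :=
  [/\ generates_relatively,
      finite_set Rs,
      forall n w, Rs w -> Rs (rot n w),
      forall w, Rs w -> Rs (word_inv w)
    & normal_closure Rs = [set w | word_val w = 1]%classic].

Definition conj_product (Rs : set word) (k : nat) (w : word) : Prop :=
  exists f r : 'I_k -> word,
    (forall i, Rs (r i)) /\
    eqF w (\big[cat/[::]]_(i < k) (word_inv (f i) ++ r i ++ f i)).

Definition relative_isoperimetric (Rs : set word) (f : nat -> nat) : Prop :=
  forall n w, size w <= n -> word_val w = 1 ->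
    exists2 k, k <= f n & conj_product Rs k w.

Definition relative_Dehn (Rs : set word) (f : nat -> nat) : Prop :=
  relative_isoperimetric Rs f /\
  forall f', relative_isoperimetric Rs f' -> forall n, f n <= f' n.

(* A path in the Cayley graph with respect to X and the H_i is given by its
   initial vertex and its label. *)
Definition path_vertices (f : G) (p : word) : seq G :=
  f :: scanl (fun v l => v * letter_val l) f p.

Definition is_path (f g : G) (p : word) : Prop := f * word_val p = g.

Definition geodesic (f g : G) (p : word) : Prop :=
  is_path f g p /\ forall q, is_path f g q -> size p <= size q.

Definition relatively_quasiconvex (R : groupClosed G) : Prop :=
  exists2 sigma : nat, 0 < sigma &
    forall (f g : G) (p : word), f \in R -> g \in R -> geodesic f g p ->
    forall v, v \in path_vertices f p ->
    exists2 w, w \in R & dist X v w <= sigma.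

(* In mathcomp, [h ^ g] is g^-1 * h * g. *)
Definition strongly_relatively_quasiconvex (R : groupClosed G) : Prop :=
  relatively_quasiconvex R /\
  forall (i : 'I_m) (g : G),
    finite_set ([set` R] `&` [set h ^ g | h in [set` H i]])%classic.

End RelativeWords.

Definition relatively_hyperbolic (G : groupType) (m : nat)
    (H : 'I_m -> groupClosed G) : Prop :=
  exists (X : {fset G}) (Rs : set (word X H)) (f : nat -> nat) (L : nat),
    [/\ finite_relative_presentation Rs, relative_Dehn Rs f
      & forall n, f n <= (L * n)%N].

(* Main.v *)
Require Import Defs.
From mathcomp Require Import all_boot finmap.
From mathcomp Require Import boolp classical_sets functions cardinality.

(* Let Q = P :&: R, and let v be a vertex of a geodesic joining two points of Q.
   Quasi-convexity gives every vertex u of the remaining part of the geodesic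
   two short elements x, y with u x in P and u y in R.  Two vertices u, u' with
   the same pair (x, y) satisfy u u'^-1 in Q, so the piece between them can be
   cut out without leaving the set of paths ending in Q; hence some path from v
   to Q has at most as many edges as there are pairs, and its labels occur in
   the geodesic.  A peripheral label h satisfies x^-1 h x' in P for short x, x',
   and strong quasi-convexity of P leaves finitely many such h, so the edges of
   that path have bounded length with respect to X. *)

Set Implicit Arguments.
Unset Strict Implicit.
Unset Printing Implicit Defensive.

Local Open Scope group_scope.

Section WordMetricTheory.
Variables (G : groupType) (X : {fset G}).
Hypothesis genX : generates X.
Implicit Types (g h u v w : G) (n : nat).

Lemma word_length_min g n : has_length X g n -> word_length X g <= n.
Proof.
move=> gn; rewrite /word_length; case: pselect => // ex.
by case: ex_minnP => k _; apply; apply/asboolP.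
Qed.

Lemma has_word_length g : has_length X g (word_length X g).
Proof.
rewrite /word_length; case: pselect => [ex|[]].
  by case: ex_minnP => k /asboolP.
by have [w gw] := genX g; exists (size w); apply/asboolP; exists w.
Qed.

Lemma word_lengthM g h :
  word_length X (g * h) <= word_length X g + word_length X h.
Proof.
have [[u <- gu] [v <- hv]] := (has_word_length g, has_word_length h).
apply: word_length_min; exists (u ++ v); first by rewrite size_cat.
by rewrite big_cat -gu -hv.
Qed.

Lemma dist_refl v : dist X v v = 0.
Proof.
apply/eqP; rewrite -leqn0 /dist mulVg.
by apply: word_length_min; exists [::]; rewrite ?big_nil.
Qed.

Lemma dist_triangle v u w : dist X u w <= dist X u v + dist X v w.
Proof.
have -> : dist X u w = word_length X ((u^-1 * v) * (v^-1 * w)).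
  by rewrite mulgA mulgK.
exact: word_lengthM.
Qed.

Lemma dist_mul g u v : dist X (g * u) (g * v) = dist X u v.
Proof. by rewrite /dist invgM -mulgA mulKg. Qed.

Lemma word_ball_finite n :
  exists s : seq G, forall g, word_length X g <= n -> g \in s.
Proof.
exists (flatten [seq [seq \prod_(x <- t) gen_val x | t : k.-tuple (X * bool)]
                | k <- iota 0 n.+1]) => g gn.
have [w ws gw] := has_word_length g.
apply/flatten_mapP; exists (size w); first by rewrite mem_iota /= add0n ltnS ws.
by apply/mapP; exists (in_tuple w); rewrite ?mem_enum.
Qed.

Lemma word_length_finite_bound (A : set G) :
  finite_set A -> exists C, forall g, A g -> word_length X g <= C.
Proof.
case/finite_seqP=> s ->; exists (\max_(g <- s) word_length X g) => g gs.
exact: leq_bigmax_seq.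
Qed.

(* Vertices of the same colour are interchangeable by a left translation
   preserving Q, so a walk ending in Q need not repeat a colour. *)
Lemma dist_colored_path (T : eqType) (Q : groupClosed G) (col : G -> T)
    (C : nat) (S : seq T) (v : G) (p : seq G) :
    {in v :: p, forall u, col u \in S} ->
    {in v :: p &, forall u u', col u = col u' -> u * u'^-1 \in Q} ->
    path (fun u u' => dist X u u' <= C) v p -> last v p \in Q ->
  exists2 w, w \in Q & dist X v w <= size S * C.
Proof.
have [n] := ubnP (size p); elim: n => // n IHn in v p S *.
rewrite ltnS => pn colS colQ vp Qlast.
(* If the colour of [v] recurs at a later [u], the walk is cut down to its tail from [u]. Left
   translation by [v * u^-1], an element of [Q], then carries the point found for [u] to one equally
   far from [v]. *)
have [/hasP[u up /eqP cu]|nocol] := boolP (has (fun u => col u == col v) p).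
  case/splitPr: up => p1 p2 in pn colS colQ vp Qlast *.
  have sub : {subset u :: p2 <= v :: p1 ++ u :: p2}.
    by move=> x xp; rewrite in_cons mem_cat xp !orbT.
  have [|||||w Qw dw] := IHn u p2 S.
  - by apply: leq_trans pn; rewrite size_cat /= addnS ltnS leq_addl.
  - by move=> x /sub; apply: colS.
  - by move=> x y /sub xp /sub yp; apply: colQ.
  - by move: vp; rewrite cat_path /= => /and3P[].
  - by move: Qlast; rewrite last_cat.
  exists (v * u^-1 * w).
    by rewrite gpredM //; apply: colQ => //; rewrite ?mem_head ?sub ?mem_head.
  by rewrite -{1}(mulgVK u v) dist_mul.
case: p => [|u p] in pn colS colQ vp Qlast nocol *.
  by exists v; rewrite ?dist_refl.
have colv : col v \in S by apply: colS; apply: mem_head.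
move: vp => /= /andP[vu up].
have [|||||w Qw dw] := IHn u p (rem (col v) S) => //.
- move=> x xp; have xS : col x \in S by apply: colS; rewrite in_cons xp orbT.
  move: xS; rewrite (perm_mem (perm_to_rem colv)) in_cons => /predU1P[cx|//].
  by case/hasP: nocol; exists x => //; apply/eqP.
- by move=> x y xp yp; apply: colQ; rewrite in_cons ?xp ?yp orbT.
exists w => //; apply: leq_trans (dist_triangle u _ _) _.
rewrite (perm_size (perm_to_rem colv)) /= mulSn; exact: leq_add.
Qed.

End WordMetricTheory.

Section RelativePaths.
Variables (G : groupType) (X : {fset G}) (m : nat) (H : 'I_m -> groupClosed G).
Implicit Types (f : G) (p : word X H).

Local Notation vertices f p := (scanl (fun v l => v * letter_val l) f p).

Lemma last_vertices f p : last f (vertices f p) = f * word_val p.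
Proof.
rewrite /word_val; elim: p f => [|l p IHp] f /=; first by rewrite big_nil mulg1.
by rewrite IHp big_cons mulgA.
Qed.

Lemma path_vertices_step f p :
  path (fun u v => `[< exists l : letter X H, v = u * letter_val l >])
    f (vertices f p).
Proof.
by elim: p f => //= l p IHp f; rewrite IHp andbT; apply/asboolP; exists l.
Qed.

(** If [h] and [h0] both satisfy the condition, then [(h * h0^-1) ^ x] lies in [P] and in the
    conjugate of [H i] by [x], a finite intersection. Hence [h] takes finitely many values once one
    [h0] is fixed. *)
Lemma peripheral_edge_bound (genX : generates X) (P : groupClosed G) (i : 'I_m) :
    (forall g, finite_set
       ([set` P] `&` [set h ^ g | h in [set` H i]])%classic) ->
  forall x y, exists C, forall h, h \in H i -> x^-1 * h * y \in P ->
    word_length X h <= C.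
Proof.
move=> finP x y.
have [[h0 [Hh0 Ph0]]|noh] :=
    pselect (exists h0, h0 \in H i /\ x^-1 * h0 * y \in P); last first.
  by exists 0 => h Hh Ph; case: noh; exists h.
have [C boundC] := word_length_finite_bound X
  (finite_image (fun z => z ^ x^-1 * h0) (finP x)).
exists C => h Hh Ph; apply: boundC; exists ((h * h0^-1) ^ x); last first.
  by rewrite conjgK mulgVK.
split; last by exists (h * h0^-1) => //=; rewrite gpredM ?gpredV.
rewrite /=; have -> : (h * h0^-1) ^ x = x^-1 * h * y * (x^-1 * h0 * y)^-1.
  by rewrite conjgE !invgM invgK !mulgA mulgK.
by rewrite gpredM ?gpredV.
Qed.

End RelativePaths.

Theorem theorem1p11 (G : groupType) (m : nat) (H : 'I_m -> groupClosed G)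
    (hyp : relatively_hyperbolic H)
    (X : {fset G}) (genX : generates X)
    (P R : groupClosed G)
    (qcP : strongly_relatively_quasiconvex X H P)
    (qcR : strongly_relatively_quasiconvex X H R) :
  strongly_relatively_quasiconvex X H (subgroupI P R).
Proof.
case: qcP qcR => -[sP _ nearP] finP [[sR _ nearR] _]; split; last first.
  move=> i g; apply: sub_finite_set (finP i g) => z [/andP[zP _] zH].
  by split.
have [BP ballP] := word_ball_finite genX sP.
have [BR ballR] := word_ball_finite genX sR.
have edge (t : 'I_m * G * G) : exists C, forall h, h \in H t.1.1 ->
    t.1.2^-1 * h * t.2 \in P -> word_length X h <= C.
  exact: peripheral_edge_bound.
have {edge} [C0 C0P] := choice edge.
(* The 1 covers edges labelled by generators in [X], the maximum covers peripheral edges. *)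
pose C := maxn 1
  (\max_(i : 'I_m) \max_(x <- BP) \max_(y <- BP) C0 (i, x, y)).
(* The successor only makes the constant positive. *)
exists (size [seq (x, y) | x <- BP, y <- BR] * C).+1 => //.
move=> f g p /andP[fP fR] /andP[gP gR] geo v vp.
have color u : exists c : G * G, u \in path_vertices f p ->
    [/\ c.1 \in BP, c.2 \in BR, u * c.1 \in P & u * c.2 \in R].
  (* Off the geodesic the colour is the arbitrary value [(1, 1)]. *)
  have [up|] := boolP (u \in path_vertices f p); last by exists (1, 1).
  have [a aP ua] := nearP _ _ _ fP gP geo u up.
  have [b bR ub] := nearR _ _ _ fR gR geo u up.
  by exists (u^-1 * a, u^-1 * b); rewrite /= !mulVKg ballP ?ballR.
have {color} [col colP] := choice color.
have edgeC : {in path_vertices f p &, forall u u',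
    `[< exists l : letter X H, u' = u * letter_val l >] -> dist X u u' <= C}.
  move=> u u' up u'p /asboolP[l u'E]; rewrite /dist u'E mulKg leq_max.
  case: l => [s|i h] /= in u'E *.
    by rewrite word_length_min //; exists [:: s]; rewrite ?big_seq1.
  have [xB _ uP _] := colP u up; have [yB _ u'P _] := colP u' u'p.
  have /andP[hH _] := valP h.
  apply/orP; right; apply: leq_trans (C0P (i, (col u).1, (col u').1) _ hH _) _.
    (* With [x], [y] the [P]-colours of [u], [u'], the product of [u * x] and [x^-1 * h * y] is
       [u' * y], which lies in [P]. *)
    rewrite /= -(gpredMl _ uP).
    by rewrite -!mulgA mulVKg (mulgA u) -u'E.
  apply: leq_trans (leq_bigmax_cond _ (erefl true : xpredT i)).
  apply: leq_trans (leq_bigmax_seq _ xB isT).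
  exact: leq_bigmax_seq _ yB isT.
have := path_vertices_step f p; have := last_vertices f p.
case: geo => -> _; rewrite /path_vertices in vp colP edgeC.
(* Only the piece from [v] to [g] is kept; it ends in both subgroups. *)
case/splitPl: vp colP edgeC => s1 s2 <-; rewrite last_cat cat_path.
set v' := last f s1 => colP edgeC gE /andP[_ pathv].
have sub : {subset v' :: s2 <= f :: s1 ++ s2}.
  move=> x; rewrite in_cons -cat_cons mem_cat => /predU1P[->|->].
    by rewrite mem_last.
  by rewrite orbT.
have [||||w wQ dw] := dist_colored_path genX (Q := subgroupI P R) (col := col)
  (C := C) (S := [seq (x, y) | x <- BP, y <- BR]) (v := v') (p := s2).
- move=> u /sub /colP[uB uB' _ _]; rewrite [col u]surjective_pairing.
  exact: allpairs_f.
- move=> u u' /sub /colP[_ _ uP uR] /sub /colP[_ _ u'P u'R] cuu'.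
  (* Taking for [z] the first common colour component gives membership in [P], the second gives
     membership in [R]. *)
  have E z : u * u'^-1 = u * z * (u' * z)^-1 by rewrite invgM !mulgA mulgK.
  rewrite inE {1}(E (col u).1) (E (col u).2).
  by rewrite !gpredF // cuu'.
- apply: (sub_in_path (P := [in v' :: s2])) pathv; last exact/allP.
  by move=> u u' /sub up /sub u'p; apply: edgeC.
- by rewrite gE inE gP gR.
by exists w => //; apply: leqW.
Qed.
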